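(* Let $h:\mathbb{R}\to\mathbb{R}$ and $\varphi:(0,\infty)\to(0,\infty)$. If the limit $$K_h(x):=\lim_{t\to\infty}[h(t+x\varphi(t))-h(t)]$$ exists (for each $x$), and $h,\varphi\in\mathbf{\Delta}^1_2$ (i.e. their graphs are $\mathbf{\Delta}^1_2$), then the graph of $K_h$ is $\mathbf{\Delta}^1_2$.
   Context: The classes are those of the (boldface) projective hierarchy in Euclidean space: $\mathbf{\Sigma}^1_1$ denotes the analytic sets, $\mathbf{\Pi}^1_1$ their complements, $\mathbf{\Sigma}^1_{2}$ the projections of $\mathbf{\Pi}^1_1$ sets, $\mathbf{\Pi}^1_{2}$ the complements of $\mathbf{\Sigma}^1_{2}$ sets, and $\mathbf{\Delta}^1_2:=\mathbf{\Sigma}^1_2\cap\mathbf{\Pi}^1_2$. Functions are identified with their graphs. *)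

(* Defs.v *)
From HB Require Import structures.
From mathcomp Require Import all_boot all_order all_algebra.
From mathcomp Require Import all_classical all_reals all_analysis.
Set Implicit Arguments.
Unset Strict Implicit.
Unset Printing Implicit Defensive.
Import Order.TTheory GRing.Theory Num.Theory.
Import numFieldNormedType.Exports.
Local Open Scope classical_set_scope.
Local Open Scope ring_scope.

Definition Borel (T : topologicalType) (A : set T) : Prop := <<s @open T >> A.

(* The boldface projective classes. They are meant for a Euclidean space T,
   such as R or R * R; then T * R, with the product topology, is the Euclidean
   space of one dimension more, and [fst @` B] is the projection of B along the
   last coordinate. *)

(* Analytic sets, in the classical form given by Lusin for Euclidean spaces:
   projections of Borel sets. *)
Definition Sigma11 (R : realType) (T : topologicalType) (A : set T) : Prop :=
  exists2 B : set (T * R), Borel B & A = fst @` B.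

Definition Pi11 (R : realType) (T : topologicalType) (A : set T) : Prop :=
  Sigma11 R (~` A).

Definition Sigma12 (R : realType) (T : topologicalType) (A : set T) : Prop :=
  exists2 B : set (T * R), Pi11 R B & A = fst @` B.

Definition Pi12 (R : realType) (T : topologicalType) (A : set T) : Prop :=
  Sigma12 R (~` A).

Definition Delta12 (R : realType) (T : topologicalType) (A : set T) : Prop :=
  Sigma12 R A /\ Pi12 R A.

(* The graph of the restriction of f to D, as a subset of the plane. *)
Definition graph (R : realType) (D : set R) (f : R -> R) : set (R * R) :=
  [set p | D p.1 /\ p.2 = f p.1].

Definition Beurling_diff (R : realType) (h phi : R -> R) (x t : R) : R :=
  h (t + x * phi t) - h t.

(* Junk value when the limit does not exist. *)
Definition Beurling_kernel (R : realType) (h phi : R -> R) (x : R) : R :=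
  lim (Beurling_diff h phi x t @[t --> +oo]).

(* Main.v *)
Require Import Defs.
From mathcomp Require Import all_boot all_order all_algebra.
From mathcomp Require Import all_classical all_reals all_analysis.
From mathcomp Require Import measurable_realfun.
From mathcomp Require Import zify lra.
Set Implicit Arguments.
Unset Strict Implicit.
Unset Printing Implicit Defensive.
Import Order.TTheory GRing.Theory Num.Theory.
Import numFieldNormedType.Exports.
Local Open Scope classical_set_scope.
Local Open Scope ring_scope.

(** For each integer n the number n + x phi(n) depends on x through the two
    constants n and phi(n) only.  As the limit along all reals t exists, it is
    the limit along the integers, so y = K_h(x) means that for every k there is
    an N with |y - (h(n + x phi(n)) - h(n))| < 1/(k+1) for all n >= N.  Each of
    these conditions is obtained from the graph of h by an affine change of
    variables and one existential real quantifier
      exists z, z = h(n + x phi(n)) /\ |y - (z - h(n))| < 1/(k+1),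
    and its negation has the same form because h is total; so it is Delta^1_2
    ([Delta12_graph_substitution]).  The graph of K_h is then a countable
    intersection of countable unions of countable intersections of Delta^1_2
    sets ([Delta12_pointwise_limit]).

    What has to be supplied is the closure of Sigma^1_2 under Borel preimages,
    countable unions, countable intersections and projections.  Sigma^1_1 and
    Sigma^1_2 arise from the Borel sets by alternating complements and
    projections along R, so it suffices that such closure properties survive
    these two operations ([adequate_dual], [adequate_projection],
    [projection_projection]).  For projections, a countable intersection or a
    second projection asks for several real witnesses at once, and only one is
    available; a Borel surjection from R onto the sequences of reals
    ([Borel_surjection_real_seq]) packs them into one. *)

(** * Borel sets and Borel maps *)

Section Borel_sets.
Context {T : topologicalType}.
Implicit Types A B : set T.

Lemma Borel_open A : open A -> Borel A.
Proof. exact: sub_sigma_algebra. Qed.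

Lemma BorelC A : Borel A -> Borel (~` A).
Proof. by rewrite -setTD; exact: sigma_algebraCD. Qed.

Lemma Borel_bigcup (F : (set T)^nat) :
  (forall n, Borel (F n)) -> Borel (\bigcup_n F n).
Proof. exact: sigma_algebra_bigcup. Qed.

Lemma Borel_bigcap (F : (set T)^nat) :
  (forall n, Borel (F n)) -> Borel (\bigcap_n F n).
Proof.
move=> BF; rewrite -[X in Borel X]setCK setC_bigcap.
by apply: BorelC; apply: Borel_bigcup => n; exact: BorelC.
Qed.

Lemma BorelI A B : Borel A -> Borel B -> Borel (A `&` B).
Proof.
move=> bA bB; rewrite -bigcap2E; apply: Borel_bigcap => -[|[|n]] //=.
exact: Borel_open openT.
Qed.

Lemma countable_bigcup_Borel (I : Type) (D : set I) (F : I -> set T) :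
  countable D -> (forall i, D i -> Borel (F i)) -> Borel (\bigcup_(i in D) F i).
Proof.
move=> /pfcard_geP[->|[g]] BF.
  by rewrite bigcup_set0; exact: (Borel_open open0).
have -> : \bigcup_(i in D) F i = \bigcup_n F (g n).
  apply/seteqP; split=> x [i Di Fx]; last by exists (g i) => //; exact: funS.
  by have [n _ gn] := @surj _ _ _ _ g _ Di; exists n => //; rewrite gn.
by apply: Borel_bigcup => n; apply: BF; exact: funS.
Qed.

End Borel_sets.

Definition Borel_map (S T : topologicalType) (f : S -> T) :=
  forall A, Borel A -> Borel (f @^-1` A).

Section Borel_maps.
Implicit Types S T V : topologicalType.

(** The sets with a Borel preimage form a sigma-algebra. *)
Lemma open_preimage_Borel_map S T (f : S -> T) :
  (forall U, open U -> Borel (f @^-1` U)) -> Borel_map f.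
Proof.
move=> fU A; move: A; apply: smallest_sub => //; split.
- by rewrite /= preimage_set0; exact: (Borel_open open0).
- by move=> A /= BA; rewrite setTD preimage_setC; exact: BorelC.
- by move=> A /= BA; rewrite preimage_bigcup; exact: Borel_bigcup.
Qed.

Lemma continuous_Borel_map S T (f : S -> T) : continuous f -> Borel_map f.
Proof.
by move=> /continuousP cf; apply: open_preimage_Borel_map => U /cf/Borel_open.
Qed.

Lemma Borel_map_comp S T V (g : T -> V) (f : S -> T) :
  Borel_map g -> Borel_map f -> Borel_map (g \o f).
Proof. by move=> bg bf A /bg/bf. Qed.

Lemma Borel_map_fst S T : Borel_map (@fst S T).
Proof. by apply: continuous_Borel_map => -[x y]; exact: cvg_fst. Qed.

Lemma Borel_map_snd S T : Borel_map (@snd S T).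
Proof. by apply: continuous_Borel_map => -[x y]; exact: cvg_snd. Qed.

Lemma second_countable_prod S T : @second_countable S -> @second_countable T ->
  @second_countable (S * T)%type.
Proof.
move=> [B cB [oB bB]] [C cC [oC bC]].
exists ((fun VW : set S * set T => VW.1 `*` VW.2) @` (B `*` C)).
  by apply: (card_le_trans (card_image_le _ _)); exact: countableX.
split=> [_ [[V W] [/= /oB oV /oC oW] <-]|[x y] U [[V W] /= [Vx Wy] VWU]].
  rewrite openE => -[x y] [/= Vx Wy]; exists (V, W) => //.
  by split; exact: open_nbhs_nbhs.
have [V' [BV' V'x] V'V] := bB x _ Vx; have [W' [CW' W'y] W'W] := bC y _ Wy.
exists (V' `*` W'); first by split=> //; exists (V', W').
by move=> [a b] [/= /V'V Va /W'W Wb]; exact: VWU.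
Qed.

(** Second countability makes an open set of the product a countable union of
    open rectangles, whose preimages are intersections of two Borel sets. *)
Lemma Borel_map_pair S T V (f : S -> T) (g : S -> V) :
  @second_countable T -> @second_countable V ->
  Borel_map f -> Borel_map g -> Borel_map (fun x => (f x, g x)).
Proof.
move=> [B cB [oB bB]] [C cC [oC bC]] bf bg.
apply: open_preimage_Borel_map => U oU.
pose D := [set VW : set T * set V | (B `*` C) VW /\ VW.1 `*` VW.2 `<=` U].
have -> : (fun x => (f x, g x)) @^-1` U =
    \bigcup_(VW in D) (f @^-1` VW.1 `&` g @^-1` VW.2).
  apply/seteqP; split=> [x Ux|x [[W Z] [_ WZU] [/= Wx Zx]]]; last exact: WZU.
  have /= : nbhs (f x, g x) U by exact: open_nbhs_nbhs.
  move=> [[W Z] /= [Wfx Zgx] WZU].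
  have [W' [BW' W'x] W'W] := bB _ _ Wfx; have [Z' [CZ' Z'x] Z'Z] := bC _ _ Zgx.
  exists (W', Z') => //; split=> //.
  by move=> [a b] [/= /W'W Va /Z'Z Wb]; exact: WZU.
apply: countable_bigcup_Borel.
  apply: (@sub_countable _ _ _ (B `*` C)); last exact: countableX.
  by apply: subset_card_le => VW [].
move=> [W Z] [[/= /oB oW /oC oZ] _].
by apply: BorelI; [apply: bf|apply: bg]; exact: Borel_open.
Qed.

End Borel_maps.

Lemma second_countable_real (R : realType) : @second_countable R.
Proof.
exists (range (fun cr : rat * rat => ball (ratr cr.1 : R) (ratr cr.2))).
  by apply: (card_le_trans (card_image_le _ _)); exact: countableP.
split=> [_ [cr _ <-]|x U]; first exact: ball_open.
rewrite nbhsE => -[V [oV Vx] VU].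
have [c [r [/set_mem xB BV]]] := @open_subball_rat _ V x oV (mem_set Vx).
exists (ball (ratr c : R) (ratr r)); last exact: subset_trans VU.
by split=> //; exists (c, r).
Qed.

(** * A Borel surjection from the line onto the sequences of reals *)

(** The integer with ternary digits [b 0], ..., [b k.-1], the first being the
    most significant. *)
Fixpoint ternary_prefix (b : nat -> bool) (k : nat) : nat :=
  if k is k'.+1 then (3 * ternary_prefix b k' + b k')%N else 0%N.

(** The nonnegative reals whose digit of weight 3^-(m+1) in base 3 is 1. *)
Definition ternary_digit1 (R : realType) (m : nat) : set R :=
  \bigcup_N `[(3 * N + 1)%:R / 3 ^+ m.+1, (3 * N + 2)%:R / 3 ^+ m.+1[%classic.

(** The witness is the real with ternary expansion 0.b_0 b_1 b_2 ...  Base 3 is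
    used because the digit 2 never occurs: the tail after any place is at most
    half a unit of that place, so no carry can make a digit ambiguous. *)
Lemma ternary_digit1_onto (R : realType) (b : nat -> bool) :
  exists x : R, forall m, ternary_digit1 m x <-> b m.
Proof.
pose N := ternary_prefix b.
(* [U k] truncates the expansion after [k] digits, and [V k] continues the
   truncation with ones: 1/3 + 1/9 + ... = 1/2. *)
pose U k : R := (N k)%:R / 3 ^+ k; pose V k : R := ((N k)%:R + 2^-1) / 3 ^+ k.
have e0 k : 0 < (3 : R) ^+ k by rewrite exprn_gt0.
have NS k : (N k.+1)%:R = 3 * (N k)%:R + (b k)%:R :> R.
  by rewrite /N /= natrD natrM.
have b01 k : 0 <= ((b k)%:R : R) <= 1 by case: (b k); rewrite ?lexx ?ler01.
have divS (a : R) k : a / 3 ^+ k.+1 = a / 3 / 3 ^+ k.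
  by rewrite exprS invfM mulrA.
have ndU : nondecreasing_seq U.
  apply/nondecreasing_seqP => k; rewrite /U NS divS ler_pM2r ?invr_gt0//.
  by have := b01 k; lra.
have niV : nonincreasing_seq V.
  apply/nonincreasing_seqP => k; rewrite /V NS divS ler_pM2r ?invr_gt0//.
  by have := b01 k; lra.
have UV i j : U i <= V j.
  apply: (le_trans (ndU _ _ (leq_maxl i j))).
  apply: (le_trans _ (niV _ _ (leq_maxr i j))).
  by rewrite /U /V ler_pM2r ?invr_gt0//; lra.
have supU : has_sup (range U).
  by split; [exists (U 0%N), 0%N|exists (V 0%N) => _ [i _ <-]].
exists (sup (range U)) => m; set x := sup _.
have Ux k : U k <= x by apply: sup_upper_bound => //; exists k.
have xV k : x <= V k by apply: ge_sup; [exact: supU.1|move=> _ [i _ <-]].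
have := Ux m.+1; have := xV m.+1; rewrite /U /V NS => xV1 Ux1.
split=> [[M _] /=|bm].
  rewrite in_itv/= => /andP[Mx xM]; apply: contraT => /negbTE bm.
  rewrite bm addr0 in xV1 Ux1.
  have := le_trans Mx xV1; rewrite ler_pM2r ?invr_gt0// => MN.
  have := le_lt_trans Ux1 xM; rewrite ltr_pM2r ?invr_gt0// => NM.
  have {}MN : (3 * M + 1 < 3 * N m + 1)%N.
    by rewrite -(ltr_nat R) [ltRHS]natrD natrM; lra.
  have {}NM : (3 * N m < 3 * M + 2)%N by rewrite -(ltr_nat R) natrM.
  by lia.
exists (N m) => //=; rewrite in_itv/=; rewrite bm in xV1 Ux1.
have -> : (3 * N m + 1)%:R = 3 * (N m)%:R + 1 :> R by rewrite natrD natrM.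
have -> : (3 * N m + 2)%:R = 3 * (N m)%:R + 2 :> R by rewrite natrD natrM.
rewrite Ux1 (le_lt_trans xV1)// ltr_pM2r ?invr_gt0//=; lra.
Qed.

Lemma measurable_ternary_digit1 (R : realType) m :
  measurable (ternary_digit1 m : set R).
Proof. by apply: bigcupT_measurable => N; exact: measurable_itv. Qed.

(** The real whose lower Dedekind cut is coded by the indices [j] of the sets
    [E j] that contain [x], where [j] stands for the rational that it encodes.
    An index that encodes no rational stands for 0, so 0 is listed repeatedly.
    [esups _ 0] is the supremum of the whole sequence. *)
Definition dedekind_cut_sup (R : realType) (E : nat -> set R) (x : R) : R :=
  fine (esups (fun j => if x \in E j then (ratr (odflt 0 (unpickle j)))%:E
                        else -oo%E) 0%N).

Lemma measurable_dedekind_cut_sup (R : realType) (E : nat -> set R) :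
  (forall j, measurable (E j)) -> measurable_fun setT (dedekind_cut_sup E).
Proof.
move=> mE.
pose g (x : R) : \bar R := esups (fun j =>
  if x \in E j then (ratr (odflt 0 (unpickle j)))%:E else -oo%E) 0%N.
rewrite (_ : dedekind_cut_sup E = fine \o g)//.
apply: (measurableT_comp (fine_measurable measurableT)).
apply: measurable_fun_esups => j.
apply: measurable_fun_ifT => //.
apply: (measurable_fun_bool true).
rewrite setTI [X in measurable X](_ : _ = E j)//.
by apply/seteqP; split=> x; [exact: set_mem|exact: mem_set].
Qed.

Lemma dedekind_cut_supE (R : realType) (E : nat -> set R) (x z : R) :
  (forall j, E j x <-> ratr (odflt 0 (unpickle j)) < z) ->
  dedekind_cut_sup E x = z.
Proof.
move=> Ez; rewrite /dedekind_cut_sup /esups /=.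
set S := ereal_sup _; rewrite (_ : S = z%:E)//.
apply/eqP; rewrite eq_le; apply/andP; split.
  apply: ge_ereal_sup => _ [j _ <-].
  case: ifPn => [/set_mem/Ez jz|_]; last by rewrite leNye.
  by rewrite lee_fin ltW.
rewrite leNgt; apply/negP => Sz.
have [r Sr rz] : exists2 r, (S <= r%:E)%E & r < z.
  move: Sz; case: S => [r rz|//|_]; first by exists r.
  by exists (z - 1); [rewrite leNye|rewrite ltrBlDr ltrDl].
have [q] := rat_in_itvoo rz; rewrite in_itv/= => /andP[rq qz].
suff : ((ratr q)%:E <= r%:E)%E by rewrite lee_fin leNgt rq.
apply: le_trans Sr; apply: ereal_sup_ubound; exists (pickle q) => //.
by rewrite pickleK/= mem_set//; apply/Ez; rewrite pickleK.
Qed.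

Lemma measurable_Borel (R : realType) (A : set R) : measurable A -> Borel A.
Proof.
rewrite [measurable](RGenOpens.measurableE R).
apply: smallest_sub; first exact: smallest_sigma_algebra.
by move=> _ [x [y ->]]; apply: Borel_open; exact: itv_open.
Qed.

(** A sequence of reals is a sequence of Dedekind cuts, hence a double sequence
    of bits, hence the sequence of ternary digits of a single real. *)
Lemma Borel_surjection_real_seq (R : realType) : exists p : nat -> R -> R,
  (forall n, Borel_map (p n)) /\
  forall z : nat -> R, exists x, forall n, p n x = z n.
Proof.
exists (fun n => dedekind_cut_sup (fun j => ternary_digit1 (pickle (n, j)))).
split=> [n|z].
  apply: open_preimage_Borel_map => U /open_measurable mU.
  apply: measurable_Borel; rewrite -[X in measurable X]setTI.
  apply: measurable_dedekind_cut_sup => // j; exact: measurable_ternary_digit1.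
pose b m := if unpickle m is Some (n, j) then
  ratr (odflt 0 (unpickle j)) < z n else false.
have [x xb] := ternary_digit1_onto R b.
exists x => n; apply: dedekind_cut_supE => j.
by rewrite xb /b pickleK.
Qed.

(** * Closure properties of pointclasses *)

Definition pointclass := forall T : topologicalType, set (set T).

(** The closure properties that pass from a class to its dual and to its
    projection.  Both countable operations are required together because the
    dual exchanges them. *)
Record adequate (Gamma : pointclass) : Prop := Adequate {
  adequate_preimage : forall (S T : topologicalType) (f : S -> T) (A : set T),
    @second_countable S -> @second_countable T ->
    Borel_map f -> Gamma T A -> Gamma S (f @^-1` A) ;
  adequate_bigcup : forall (T : topologicalType) (F : (set T)^nat),
    @second_countable T ->
    (forall n, Gamma T (F n)) -> Gamma T (\bigcup_n F n) ;
  adequate_bigcap : forall (T : topologicalType) (F : (set T)^nat),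
    @second_countable T ->
    (forall n, Gamma T (F n)) -> Gamma T (\bigcap_n F n) }.

Definition dual (Gamma : pointclass) : pointclass := fun T A => Gamma T (~` A).

Definition projection (R : realType) (Gamma : pointclass) : pointclass :=
  fun T A => exists2 B : set (T * R), Gamma _ B & A = fst @` B.

Lemma adequate_Borel : adequate (@Borel).
Proof.
split=> [S T f A _ _ + /[dup]|T F _|T F _]; first by move=> fB _; exact: fB.
  exact: Borel_bigcup.
exact: Borel_bigcap.
Qed.

Lemma adequate_dual Gamma : adequate Gamma -> adequate (dual Gamma).
Proof.
move=> [pre cup cap]; split=> [S T f A cS cT fB|T F cT GF|T F cT GF].
- exact: pre.
- by rewrite /dual setC_bigcup; exact: cap.
- by rewrite /dual setC_bigcap; exact: cup.
Qed.

Lemma adequate_meet Gamma Gamma' : adequate Gamma -> adequate Gamma' ->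
  adequate (fun T => Gamma T `&` Gamma' T).
Proof.
move=> [pre cup cap] [pre' cup' cap'].
split=> [S T f A cS cT fB [GA GA']|T F cT GF|T F cT GF].
- by split; [exact: pre|exact: pre'].
- by split; [apply: cup => // n|apply: cup' => // n]; have [] := GF n.
- by split; [apply: cap => // n|apply: cap' => // n]; have [] := GF n.
Qed.

Section projection.
Context (R : realType).
Implicit Types (Gamma : pointclass) (S T : topologicalType).

Let second_countable_prodR T :
  @second_countable T -> @second_countable (T * R)%type.
Proof.
by move=> cT; exact: second_countable_prod cT (second_countable_real R).
Qed.

Lemma projection_preimage Gamma S T (f : S -> T) (A : set T) :
  adequate Gamma -> @second_countable S -> @second_countable T ->
  Borel_map f -> projection R Gamma A -> projection R Gamma (f @^-1` A).
Proof.
move=> aG cS cT fB [B GB ->].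
exists ((fun u : S * R => (f u.1, u.2)) @^-1` B).
  apply: (adequate_preimage aG) => //; [exact: second_countable_prodR..|].
  apply: Borel_map_pair => //; first exact: second_countable_real.
    by apply: (Borel_map_comp fB); exact: Borel_map_fst.
  exact: Borel_map_snd.
apply/seteqP; split=> [x [[y z] Byz /= yfx]|_ [[x z] Bxz <-]].
  by exists (x, z) => //=; rewrite -yfx.
by exists (f x, z).
Qed.

Lemma projection_bigcup Gamma T (F : (set T)^nat) :
  adequate Gamma -> @second_countable T ->
  (forall n, projection R Gamma (F n)) -> projection R Gamma (\bigcup_n F n).
Proof.
move=> aG cT /(_ _)/cid2-/all_sig2[B GB FB].
exists (\bigcup_n B n).
  by apply: (adequate_bigcup aG) => //; exact: second_countable_prodR.
by rewrite image_bigcup; apply: eq_bigcupr => n _.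
Qed.

(** A point lies in the intersection when it has a witness [z n] for every [n];
    a single real [w] with [p n w = z n] replaces all of them. *)
Lemma projection_bigcap Gamma T (F : (set T)^nat) :
  adequate Gamma -> @second_countable T ->
  (forall n, projection R Gamma (F n)) -> projection R Gamma (\bigcap_n F n).
Proof.
move=> aG cT /(_ _)/cid2-/all_sig2[B GB FB].
have [p [pB p_onto]] := Borel_surjection_real_seq R.
exists (\bigcap_n (fun u : T * R => (u.1, p n u.2)) @^-1` (B n)).
  apply: (adequate_bigcap aG) => [|n]; first exact: second_countable_prodR.
  apply: (adequate_preimage aG) => //; [exact: second_countable_prodR..|].
  apply: Borel_map_pair => //; first exact: second_countable_real.
    exact: Borel_map_fst.
  by apply: (Borel_map_comp (pB n)); exact: Borel_map_snd.
apply/seteqP; split=> [x Fx|_ [[x z] Bxz <-] n _]; last first.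
  by rewrite FB; exists (x, p n z) => //; exact: Bxz.
have /choice[z Bz] n : exists z, B n (x, z).
  by have := Fx n Logic.I; rewrite FB => -[[y z] Byz /= <-]; exists z.
have [w pw] := p_onto z; exists (x, w) => // n _ /=.
by rewrite pw.
Qed.

Lemma adequate_projection Gamma :
  adequate Gamma -> adequate (projection R Gamma).
Proof.
move=> aG; split=> *; [exact: projection_preimage|exact: projection_bigcup|].
exact: projection_bigcap.
Qed.

Lemma sub_projection Gamma T (A : set T) :
  adequate Gamma -> @second_countable T -> Gamma T A -> projection R Gamma A.
Proof.
move=> aG cT GA; exists (fst @^-1` A).
  apply: (adequate_preimage aG) => //; first exact: second_countable_prodR.
  exact: Borel_map_fst.
by rewrite image_preimage//; apply/seteqP; split=> // x _; exists (x, 0).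
Qed.

(** The two witnesses are packed into one real. *)
Lemma projection_projection Gamma T (A : set T) :
  adequate Gamma -> @second_countable T ->
  projection R (projection R Gamma) A -> projection R Gamma A.
Proof.
move=> aG cT [_ [B GB ->] ->].
have [p [pB p_onto]] := Borel_surjection_real_seq R.
exists ((fun u : T * R => ((u.1, p 0%N u.2), p 1%N u.2)) @^-1` B).
  apply: (adequate_preimage aG) => //.
  - exact: second_countable_prodR.
  - by do 2!apply: second_countable_prodR.
  have Bp n : Borel_map (fun u : T * R => p n u.2).
    by apply: (Borel_map_comp (pB n)); exact: Borel_map_snd.
  have cR := second_countable_real R.
  apply: Borel_map_pair => //; first exact: second_countable_prodR.
  by apply: Borel_map_pair => //; exact: Borel_map_fst.
apply/seteqP; split=> [_ [_ [[[x y] z] Bxyz <-] <-]|_ [[x u] Bu <-]].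
  have [u pu] := p_onto (fun n => if n is 0%N then y else z).
  by exists (x, u) => //=; rewrite /= !pu.
by exists (x, p 0%N u) => //; exists ((x, p 0%N u), p 1%N u).
Qed.

End projection.

Lemma adequateI (Gamma : pointclass) (T : topologicalType) (A B : set T) :
  adequate Gamma -> @second_countable T ->
  Gamma T A -> Gamma T B -> Gamma T (A `&` B).
Proof.
move=> aG cT GA GB.
rewrite (_ : A `&` B = \bigcap_n (if n is 0%N then A else B)); last first.
  apply/seteqP; split=> [x [Ax Bx] [|n]//|x ABx].
  by split; [exact: (ABx 0%N)|exact: (ABx 1%N)].
by apply: (adequate_bigcap aG) => // -[|n].
Qed.

(** * The classes of the second level *)

Section Delta12.
Context (R : realType).

Let countable_real := second_countable_real R.
Let countable_plane : @second_countable (R * R)%type.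
Proof. exact: second_countable_prod. Qed.

Lemma adequate_Pi11 : adequate (@Pi11 R).
Proof. exact: adequate_dual (adequate_projection R adequate_Borel). Qed.

Lemma adequate_Sigma12 : adequate (@Sigma12 R).
Proof. exact: adequate_projection adequate_Pi11. Qed.

Lemma adequate_Delta12 : adequate (@Delta12 R).
Proof.
exact: adequate_meet adequate_Sigma12 (adequate_dual adequate_Sigma12).
Qed.

Lemma Borel_Sigma12 (T : topologicalType) (A : set T) :
  @second_countable T -> Borel A -> Sigma12 R A.
Proof.
move=> cT BA; apply: (@sub_projection R (@Pi11 R) T A adequate_Pi11 cT).
by apply: (@sub_projection R (@Borel) _ _ adequate_Borel cT); exact: BorelC.
Qed.

(** [U (f x, y)] says that some [z] satisfies [z = f x] and [U (z, y)]: this is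
    the projection of a Sigma^1_2 set. *)
Lemma Sigma12_graph_substitution (f : R -> R) (U : set (R * R)) :
  Sigma12 R (graph setT f) -> Borel U -> Sigma12 R [set q | U (f q.1, q.2)].
Proof.
move=> Sf BU; apply: (projection_projection adequate_Pi11 countable_plane).
have cS : @second_countable (R * R * R)%type by exact: second_countable_prod.
have B1 : Borel_map (fun u : R * R * R => u.1.1).
  by apply: (Borel_map_comp (@Borel_map_fst _ _)); exact: Borel_map_fst.
have B2 : Borel_map (fun u : R * R * R => u.1.2).
  by apply: (Borel_map_comp (@Borel_map_snd _ _)); exact: Borel_map_fst.
have B3 : Borel_map (fun u : R * R * R => u.2) by exact: Borel_map_snd.
exists ((fun u => (u.1.1, u.2)) @^-1` graph setT f `&`
        (fun u => (u.2, u.1.2)) @^-1` U).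
  apply: (adequateI adequate_Sigma12) => //.
    apply: (@adequate_preimage _ adequate_Sigma12 _ _
      (fun u : R * R * R => (u.1.1, u.2))) => //.
    exact: Borel_map_pair.
  apply: Borel_Sigma12 => //.
  by have := Borel_map_pair countable_real countable_real B3 B2; apply.
apply/seteqP; split=> [[x y] /= Ufy|_ [[[x y] z] [[_ /= ->] Uzy] <-]//].
by exists (x, y, f x).
Qed.

(** As [f] is total, the complement is the same kind of set, for the complement
    of [U]. *)
Lemma Delta12_graph_substitution (f : R -> R) (U : set (R * R)) :
  Sigma12 R (graph setT f) -> Borel U -> Delta12 R [set q | U (f q.1, q.2)].
Proof.
move=> Sf BU; split; first exact: (Sigma12_graph_substitution Sf BU).
exact: (Sigma12_graph_substitution Sf (BorelC BU)).
Qed.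

(** As limits are unique, [y = l x] means that [u n x] tends to [y], and this
    quantifies over integers only: the graph is obtained by countable
    operations. *)
Lemma Delta12_pointwise_limit (u : nat -> R -> R) (l : R -> R) :
  (forall n (e : R), Delta12 R [set q | `|q.2 - u n q.1| < e]) ->
  (forall x, u n x @[n --> \oo] --> l x) -> Delta12 R (graph setT l).
Proof.
move=> Du ul; pose G n k := [set q : R * R | `|q.2 - u n q.1| < k.+1%:R^-1].
rewrite (_ : graph setT l = \bigcap_k \bigcup_N \bigcap_m G (N + m)%N k).
  apply: (adequate_bigcap adequate_Delta12) => // k.
  apply: (adequate_bigcup adequate_Delta12) => // N.
  by apply: (adequate_bigcap adequate_Delta12) => // m; exact: Du.
apply/seteqP; split=> [[x y] [_ /= ->] k _|[x y] Gxy].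
  have /cvgrPdist_lt/(_ k.+1%:R^-1) := ul x.
  rewrite invr_gt0 ltr0n => /(_ isT)[N _ uN].
  by exists N => // m _; apply: uN; rewrite /= leq_addr.
split=> //=; apply: (cvg_unique _ _ (ul x)) => //.
apply/cvgrPdist_lt => e e0.
have [k ke] := ltr_add_invr e0; rewrite add0r in ke.
have [N _ GN] := Gxy k Logic.I; exists N => // n /= Nn.
apply: lt_trans ke; have := GN (n - N)%N Logic.I.
by rewrite /G /= subnKC.
Qed.

End Delta12.

(** * The kernel *)

Theorem theorem12 (R : realType) (h phi : R -> R)
    (phi_gt0 : forall t : R, 0 < t -> 0 < phi t)
    (K_exists : forall x : R, cvg (Beurling_diff h phi x t @[t --> +oo]))
    (h_Delta12 : Delta12 R (graph setT h))
    (phi_Delta12 : Delta12 R (graph `]0, +oo[ phi)) :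
  Delta12 R (graph setT (Beurling_kernel h phi)).
Proof.
apply: (@Delta12_pointwise_limit _ (fun n x => Beurling_diff h phi x n%:R)).
  (* The condition at [n] is the preimage of a condition on [(h x, y)] under the
     affine map [(x, y) |-> (n + x phi(n), y)]. *)
  move=> n e; set c := phi n%:R; set d := h n%:R.
  pose U := [set q : R * R | `|q.2 - (q.1 - d)| < e].
  have BU : Borel U.
    have cU : continuous (fun q : R * R => `|q.2 - (q.1 - d)|).
      move=> q; apply: cvg_norm; apply: cvgB; first exact: cvg_snd.
      by apply: cvgB; [exact: cvg_fst|exact: cvg_cst].
    apply: (continuous_Borel_map cU (A := [set r | r < e])).
    by apply: Borel_open; exact: open_lt.
  have cR := second_countable_real R.
  have cP := second_countable_prod cR cR.
  have /= := adequate_preimage (@adequate_Delta12 R) (f := fun q : R * R =>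
    (n%:R + q.1 * c, q.2)) cP cP _ (Delta12_graph_substitution h_Delta12.1 BU).
  apply; apply: Borel_map_pair => //; last exact: Borel_map_snd.
  apply: continuous_Borel_map => q.
  apply: cvgD; first exact: cvg_cst.
  by apply: cvgM; [exact: cvg_fst|exact: cvg_cst].
by move=> x; apply: cvg_comp (K_exists x); exact: cvgr_idn.
Qed.
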